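(* Let $X$ be a finite undirected graph with vertex set $\{1,\dots,n\}$, let $\pi$ be a permutation of the vertex set of $X$, and let $(f_v)_v$ be bi-threshold vertex functions with integer up-thresholds $k^\uparrow_v$ and down-thresholds $k^\downarrow_v$ (possibly varying from vertex to vertex) all satisfying $\Delta(v)=k^\downarrow_v-k^\uparrow_v\le 1$. Then the sequential dynamical system map $\mathbf{F}_\pi\colon\{0,1\}^n\to\{0,1\}^n$ only has fixed points as limit sets, i.e. every periodic point of $\mathbf{F}_\pi$ is a fixed point.
   Context: Graphs are finite, undirected and simple. Let $K=\{0,1\}$. For a vertex $v$, $N[v]$ denotes the closed neighborhood of $v$ ($v$ together with its neighbors). For $x\in K^n$ put $\sigma(x[v])=|\{u\in N[v] : x_u=1\}|$ (this count includes $v$ itself). The bi-threshold vertex function $f_v$ with up-threshold $k^\uparrow_v$ and down-threshold $k^\downarrow_v$ is: if $x_v=0$, then $f_v=1$ when $\sigma(x[v])\ge k^\uparrow_v$ and $f_v=0$ otherwise; if $x_v=1$, then $f_v=1$ when $\sigma(x[v])\ge k^\downarrow_v$ and $f_v=0$ otherwise. The $X$-local map $F_v\colon K^n\to K^n$ replaces the coordinate $x_v$ by $f_v$ evaluated at $x$ and leaves all other coordinates unchanged. For a permutation $\pi=(\pi_1,\dots,\pi_n)$ of the vertices, the sequential dynamical system (SDS) map is $\mathbf{F}_\pi=F_{\pi_n}\circ\cdots\circ F_{\pi_1}$. A point $x$ is periodic if $\mathbf{F}_\pi^p(x)=x$ for some $p\ge1$; the least such $p$ is its period, and $x$ is a fixed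 point if $p=1$. The limit set of a state is the unique periodic orbit reached from it. *)

(* Defs.v *)
From mathcomp Require Import all_boot all_order all_algebra all_fingroup.

Set Implicit Arguments.
Unset Strict Implicit.
Unset Printing Implicit Defensive.

Import Order.TTheory GRing.Theory Num.Theory.

(* The vertices 1, ..., n are represented by 'I_n, and a graph by its adjacency
   relation (assumed symmetric and irreflexive where it is used). *)
Definition state (n : nat) : Type := {ffun 'I_n -> bool}.

Definition closed_nbhd n (e : rel 'I_n) (v : 'I_n) : {set 'I_n} :=
  [set u | (u == v) || e v u].

Definition sigma n (e : rel 'I_n) (v : 'I_n) (x : state n) : nat :=
  #|[set u in closed_nbhd e v | x u]|.

Definition bithreshold n (e : rel 'I_n) (kup kdown : 'I_n -> int)
    (v : 'I_n) (x : state n) : bool :=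
  if x v then (kdown v <= (sigma e v x)%:Z)%R
  else (kup v <= (sigma e v x)%:Z)%R.

Definition local_map n (f : 'I_n -> state n -> bool) (v : 'I_n)
    (x : state n) : state n :=
  [ffun u => if u == v then f v x else x u].

(* [foldl] applies the local map of [pi 0] first and that of [pi (n - 1)]
   last. *)
Definition sds_map n (f : 'I_n -> state n -> bool) (pi : {perm 'I_n})
    (x : state n) : state n :=
  foldl (fun y i => local_map f (pi i) y) x (enum 'I_n).

Definition periodic_point (T : Type) (F : T -> T) (x : T) : Prop :=
  exists p : nat, 0 < p /\ iter p F x = x.

Definition fixed_point (T : Type) (F : T -> T) (x : T) : Prop := F x = x.

(* Main.v *)
Require Import Defs.
From mathcomp Require Import all_boot all_order all_algebra all_fingroup.
From mathcomp Require Import zify ring.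

(** Doubling the usual Hopfield-type energy and centring the threshold at
    [kup v - 1/2] gives an integer potential.  Vertex [v] with [N] active
    neighbours turns on only if [N >= kup v], and turns off only if
    [N + 1 < kdown v], hence [N < kup v] because [kdown v <= kup v + 1].  Either
    way the switch raises the potential by [|2 N - (2 kup v - 1)| >= 1].  A map
    along which a potential strictly increases off its fixed points has no other
    periodic points. *)

Set Implicit Arguments.
Unset Strict Implicit.
Unset Printing Implicit Defensive.

Import Order.TTheory GRing.Theory Num.Theory.
Local Open Scope ring_scope.

(** If [F x] differed from [x], [P] would rise strictly at once and never fall again, so the orbit
    could not return to [x]. *)
Lemma periodic_fixed_of_potential (T : Type) (P : T -> int) (F : T -> T) :
  (forall x, F x = x \/ P x < P (F x)) ->
  forall x, periodic_point F x -> fixed_point F x.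
Proof.
move=> PF x [[|p] [// _ Fpx]]; have [//|ltP] := PF x.
have leP m y : P y <= P (iter m F y).
  elim: m => [|m IHm] //=; apply: le_trans IHm _.
  by case: (PF (iter m F y)) => [->|/ltW].
by have := leP p (F x); rewrite -iterSr Fpx leNgt ltP.
Qed.

(** Lifts the dichotomy from single updates to a whole sweep: moves inside a sweep cannot cancel. *)
Lemma foldl_potential (T I : Type) (P : T -> int) (g : T -> I -> T) :
  (forall x i, g x i = x \/ P x < P (g x i)) ->
  forall s x, foldl g x s = x \/ P x < P (foldl g x s).
Proof.
move=> Pg; elim=> [|i s IHs] x /=; first by left.
have [->|ltP] := Pg x i; first exact: IHs.
by right; case: (IHs (g x i)) => [->//|]; apply: lt_trans.
Qed.

Section Potential.

Variables (n : nat) (e : rel 'I_n) (kup : 'I_n -> int).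
Hypotheses (e_sym : symmetric e) (e_irr : irreflexive e).

Implicit Types (v : 'I_n) (x y : state n).

Definition potential x : int :=
  \sum_w \sum_u (x w)%:R * (x u)%:R * (e w u)%:R
  - \sum_w (x w)%:R * (2 * kup w - 1).

Definition active_nbrs v x : int := \sum_(u | u != v) (x u)%:R * (e v u)%:R.

(** The self-count [x v] is what leaves room for [kdown v] to exceed [kup v] by one. *)
Lemma sigmaE v x : (sigma e v x)%:Z = (x v)%:R + active_nbrs v x.
Proof.
rewrite /sigma -sum1_card -natz natr_sum big_mkcond (bigD1 v) //= !inE eqxx /=.
congr (_ + _); first by case: (x v).
apply: eq_bigr => u /negPf uv; rewrite !inE uv /=.
by case: (e v u); case: (x u).
Qed.

Definition potential_off v x : int :=
  \sum_(w | w != v) \sum_(u | u != v) (x w)%:R * (x u)%:R * (e w u)%:R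
  - \sum_(w | w != v) (x w)%:R * (2 * kup w - 1).

(** Row and column [v] of the double sum agree by symmetry, whence the factor 2; the diagonal term
    vanishes by irreflexivity. *)
Lemma potential_split v x :
  potential x =
    (x v)%:R * (2 * active_nbrs v x - (2 * kup v - 1)) + potential_off v x.
Proof.
rewrite /potential /potential_off (bigD1 v) //= (bigD1 v) //= e_irr mulr0 add0r.
rewrite [X in _ - X](bigD1 v) //=.
have -> : \sum_(u | u != v) (x v)%:R * (x u)%:R * (e v u)%:R
          = (x v)%:R * active_nbrs v x :> int.
  by rewrite mulr_sumr; apply: eq_bigr => u _; rewrite mulrA.
(* Row [v] is already out; this takes column [v] out of the remaining rows. *)
under [X in _ + X - _]eq_bigr => w _ do rewrite (bigD1 v) //=.
rewrite big_split /=.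
have -> : \sum_(w | w != v) (x w)%:R * (x v)%:R * (e w v)%:R
          = (x v)%:R * active_nbrs v x :> int.
  rewrite mulr_sumr; apply: eq_bigr => w _.
  by rewrite e_sym mulrA (mulrC (x v)%:R).
ring.
Qed.

Lemma active_nbrs_off v x y :
  (forall u, u != v -> x u = y u) -> active_nbrs v x = active_nbrs v y.
Proof. by move=> xy; apply: eq_bigr => u uv; rewrite xy. Qed.

Lemma potential_off_off v x y :
  (forall u, u != v -> x u = y u) -> potential_off v x = potential_off v y.
Proof.
move=> xy; congr (_ - _); apply: eq_bigr => w wv; last by rewrite xy.
by apply: eq_bigr => u uv; rewrite !xy.
Qed.

Lemma local_map_potential (kdown : 'I_n -> int) v x :
  kdown v - kup v <= 1 ->
  let y := local_map (bithreshold e kup kdown) v x in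
  y = x \/ potential x < potential y.
Proof.
move=> hDelta y.
have yv : y v = bithreshold e kup kdown v x by rewrite ffunE eqxx.
have yu u : u != v -> y u = x u by rewrite ffunE => /negPf->.
have [yx|neq] := eqVneq (y v) (x v).
  by left; apply/ffunP => u; have [->|/yu] := eqVneq u v.
right; rewrite !(potential_split v) (active_nbrs_off yu) (potential_off_off yu).
move: neq; rewrite yv /bithreshold sigmaE.
(* Only the two switching cases survive [//=]; [hDelta] serves when [v] turns off. *)
by case: (x v) => /=; case: (lerP _ (_ + active_nbrs v x)) => hk //= _; lia.
Qed.

End Potential.

Theorem theorem3p5 (n : nat) (e : rel 'I_n)
    (e_sym : symmetric e) (e_irr : irreflexive e)
    (pi : {perm 'I_n}) (kup kdown : 'I_n -> int)
    (hDelta : forall v : 'I_n, (kdown v - kup v <= 1)%R)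
    (x : state n) :
  periodic_point (sds_map (bithreshold e kup kdown) pi) x ->
  fixed_point (sds_map (bithreshold e kup kdown) pi) x.
Proof.
apply: (@periodic_fixed_of_potential _ (potential e kup)) => y.
apply: foldl_potential => z i.
exact: local_map_potential.
Qed.
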